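(* Every Hausdorff monothetic semitopological monoid with open shifts is cancellative.
   Context: A semitopological monoid is a semigroup $S$ with identity endowed with a topology such that the multiplication $S\times S\to S$ is separately continuous. $S$ is monothetic if there is $a\in S$ with $S=\overline{\{a^n:n\ge 1\}}$. $S$ has open shifts if for every $a\in S$ the shifts $x\mapsto ax$ and $x\mapsto xa$ are open maps $S\to S$. $S$ is cancellative if for any $a,x,y\in S$, the equality $ax=ay$ or $xa=ya$ implies $x=y$. *)

(* Defs.v *)
From HB Require Import structures.
From mathcomp Require Import all_boot.
From mathcomp Require Import all_classical.
From mathcomp Require Import topology.

Set Implicit Arguments.
Unset Strict Implicit.
Unset Printing Implicit Defensive.

Local Open Scope classical_set_scope.
Local Open Scope group_scope.

HB.structure Definition PreTopologicalMonoid :=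
  {S of Topological S & monoid.Monoid S}.

HB.mixin Record PreTopologicalMonoid_isSemitopological S
    of PreTopologicalMonoid S := {
  mulg_continuousl : forall a : S, continuous (fun x : S => a * x);
  mulg_continuousr : forall a : S, continuous (fun x : S => x * a)
}.

#[short(type="semitopologicalMonoidType")]
HB.structure Definition SemitopologicalMonoid :=
  {S of PreTopologicalMonoid S & PreTopologicalMonoid_isSemitopological S}.

Definition monothetic (S : semitopologicalMonoidType) : Prop :=
  exists a : S, closure [set a ^+ n | n in [set n : nat | (1 <= n)%N]] = setT.

Definition open_map (X Y : topologicalType) (f : X -> Y) : Prop :=
  forall U : set X, open U -> open (f @` U).

Definition open_shifts (S : semitopologicalMonoidType) : Prop :=
  forall a : S,
    open_map (fun x : S => a * x) /\ open_map (fun x : S => x * a).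

Definition cancellative (S : monoidType) : Prop :=
  forall a x y : S, a * x = a * y \/ x * a = y * a -> x = y.

(* Main.v *)
(** If [a] is the generator, then [1] is a limit of powers [a ^+ n] with [n >= 1];
    hence [a * x = a * y] gives [a ^+ n * x = a ^+ n * y] for all those [n] and,
    in the limit, [x = y]. So every power of [a] is cancellable. For arbitrary
    [b], the images [S * b] and [b * S] are open and nonempty, so each of them
    contains a power of [a], and [b] is cancellable as well. *)
Require Import Defs.
From mathcomp Require Import all_boot.
From mathcomp Require Import all_classical.
From mathcomp Require Import topology.

Set Implicit Arguments.
Unset Strict Implicit.
Unset Printing Implicit Defensive.

Local Open Scope classical_set_scope.
Local Open Scope group_scope.

Lemma hausdorff_eq_on_dense {X Y : topologicalType} {f g : X -> Y}
    {D : set X} :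
  hausdorff_space Y -> closure D = setT -> continuous f -> continuous g ->
  (forall z, D z -> f z = g z) -> f =1 g.
Proof.
(* In [Y], points whose neighbourhoods always meet coincide; a point of [D] close to [z] gives a
   common element of [A] and [B]. *)
move=> hY cD cf cg fgD z; apply: hY => A B fzA gzB.
have Dz : closure D z by rewrite cD.
have [w [Dw [Aw Bw]]] : D `&` (f @^-1` A `&` g @^-1` B) !=set0.
  by apply: Dz; apply: filterI; [exact: cf | exact: cg].
by exists (f w); split=> //; rewrite fgD.
Qed.

Lemma open_meets_dense {X : topologicalType} {D U : set X} :
  closure D = setT -> open U -> U !=set0 -> D `&` U !=set0.
Proof.
move=> cD oU [u Uu].
have : closure D u by rewrite cD.
by apply; exact: open_nbhs_nbhs.
Qed.

Section Generator.
Variables (S : semitopologicalMonoidType) (a : S).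
Hypothesis S_hausdorff : hausdorff_space S.
Hypothesis a_dense :
  closure [set a ^+ n | n in [set n : nat | (1 <= n)%N]] = setT.

Lemma generator_mulgI (x y : S) : a * x = a * y -> x = y.
Proof.
(* The goal becomes equality at [z = 1] of the shifts [z * x] and [z * y]. *)
move=> axy; rewrite -[x]mul1g -[y]mul1g.
apply: (hausdorff_eq_on_dense S_hausdorff a_dense (mulg_continuousr x)
  (mulg_continuousr y)).
(* Exponent 0 has to be excluded: agreement there is the goal itself. *)
by move=> _ [[//|n] _ <-]; rewrite expgSr -!mulgA axy.
Qed.

Lemma generator_mulIg (x y : S) : x * a = y * a -> x = y.
Proof.
move=> axy; rewrite -[x]mulg1 -[y]mulg1.
apply: (hausdorff_eq_on_dense S_hausdorff a_dense (mulg_continuousl x)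
  (mulg_continuousl y)).
by move=> _ [[//|n] _ <-]; rewrite expgS !mulgA axy.
Qed.

Lemma generatorX_mulgI n (x y : S) : a ^+ n * x = a ^+ n * y -> x = y.
Proof.
elim: n => [|n IHn]; first by rewrite expg0 !mul1g.
by rewrite expgS -!mulgA => /generator_mulgI.
Qed.

Lemma generatorX_mulIg n (x y : S) : x * a ^+ n = y * a ^+ n -> x = y.
Proof.
elim: n => [|n IHn]; first by rewrite expg0 !mulg1.
by rewrite expgSr !mulgA => /generator_mulIg.
Qed.

Lemma open_range_generatorX (f : S -> S) :
  open_map f -> exists n s, f s = a ^+ n.
Proof.
move=> of_.
have [_ [[n _ <-] [s _ fs]]] :
    [set a ^+ n | n in [set n : nat | (1 <= n)%N]] `&` f @` setT !=set0.
  by apply: (open_meets_dense a_dense (of_ _ openT)); exists (f 1), 1.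
by exists n, s.
Qed.

End Generator.

Theorem corollary3p4 (S : semitopologicalMonoidType)
  (S_hausdorff : hausdorff_space S)
  (S_monothetic : monothetic S)
  (S_open_shifts : open_shifts S) :
  cancellative S.
Proof.
have [a a_dense] := S_monothetic.
move=> b x y; have [bS_open Sb_open] := S_open_shifts b.
case=> bxy.
(* Left cancellation takes the right shift: [c * b = a ^+ n], so multiplying by [c] on the left
   replaces [b] by a power of [a]. *)
- have [n [c cb]] := open_range_generatorX a_dense Sb_open.
  apply: (generatorX_mulgI S_hausdorff a_dense (n := n)).
  by rewrite -cb -!mulgA bxy.
- have [n [c bc]] := open_range_generatorX a_dense bS_open.
  apply: (generatorX_mulIg S_hausdorff a_dense (n := n)).
  by rewrite -bc !mulgA bxy.
Qed.
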